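(* A regular polynomial $P\in\mathbb{H}[q_1,\ldots,q_n]$ vanishes at $(a_1,\ldots,a_n)\in\mathbb{H}^n$ if and only if there exist $P_k\in\mathbb{H}[q_1,\ldots,q_k]$, for $k=1,\ldots,n$, such that $$P(q_1,\ldots,q_n)=\sum_{k=1}^n(q_k-a_k)*P_k(q_1,\ldots,q_k).$$
   Context: $\mathbb{H}$ denotes the skew field of quaternions. $\mathbb{H}[q_1,\ldots,q_n]$ is the set of (slice) regular polynomials in $n$ quaternionic variables, i.e. functions $P:\mathbb{H}^n\to\mathbb{H}$ of the form $P(q_1,\ldots,q_n)=\sum q_1^{\ell_1}\cdots q_n^{\ell_n}a_{\ell_1,\ldots,\ell_n}$ (finite sum, coefficients in $\mathbb{H}$ on the right, evaluated in exactly this order at arbitrary points of $\mathbb{H}^n$). The $*$-product is the biadditive extension of $(q_1^{\ell_1}\cdots q_n^{\ell_n}a)*(q_1^{k_1}\cdots q_n^{k_n}b)=q_1^{\ell_1+k_1}\cdots q_n^{\ell_n+k_n}ab$; it makes $\mathbb{H}[q_1,\ldots,q_n]$ an associative ring. For $k\le n$, $\mathbb{H}[q_1,\ldots,q_k]$ is regarded as the subset of $\mathbb{H}[q_1,\ldots,q_n]$ of polynomials involving only $q_1,\ldots,q_k$. *)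

(* Defs.v *)
From HB Require Import structures.
From mathcomp Require Import all_boot all_order all_algebra.
From mathcomp Require Import reals.
From mathcomp Require Import ring.
From mathcomp.multinomials Require Import ssrcomplements mpoly.

Set Implicit Arguments.
Unset Strict Implicit.
Unset Printing Implicit Defensive.

Import Order.TTheory GRing.Theory Num.Theory.
Local Open Scope ring_scope.

(* [Quat x y z w] is x + y i + z j + w k. *)
Record quaternion (R : Type) := Quat {qre : R; qimi : R; qimj : R; qimk : R}.

Section QuaternionEncoding.
Variable R : Type.
Definition quat_encode (q : quaternion R) : R * R * R * R :=
  (qre q, qimi q, qimj q, qimk q).
Definition quat_decode (u : R * R * R * R) : quaternion R :=
  let: (x, y, z, w) := u in Quat x y z w.
Lemma quat_encodeK : cancel quat_encode quat_decode.
Proof. by case. Qed.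
End QuaternionEncoding.

HB.instance Definition _ (R : eqType) :=
  Equality.copy (quaternion R) (can_type (@quat_encodeK R)).
HB.instance Definition _ (R : choiceType) :=
  Choice.copy (quaternion R) (can_type (@quat_encodeK R)).

Section QuaternionRing.
Variable R : comNzRingType.
Implicit Types p q r : quaternion R.

Definition quat_zero : quaternion R := Quat 0 0 0 0.
Definition quat_opp p : quaternion R :=
  Quat (- qre p) (- qimi p) (- qimj p) (- qimk p).
Definition quat_add p q : quaternion R :=
  Quat (qre p + qre q) (qimi p + qimi q) (qimj p + qimj q) (qimk p + qimk q).
Definition quat_one : quaternion R := Quat 1 0 0 0.
(* i^2 = j^2 = k^2 = i j k = -1 *)
Definition quat_mul p q : quaternion R :=
  let: Quat a b c d := p in let: Quat x y z w := q in
  Quat (a * x - b * y - c * z - d * w)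
       (a * y + b * x + c * w - d * z)
       (a * z - b * w + c * x + d * y)
       (a * w + b * z - c * y + d * x).

Fact quat_addA : associative quat_add.
Proof. by case=> ? ? ? ? [? ? ? ?] [? ? ? ?]; congr Quat => /=; ring. Qed.
Fact quat_addC : commutative quat_add.
Proof. by case=> ? ? ? ? [? ? ? ?]; congr Quat => /=; ring. Qed.
Fact quat_add0 : left_id quat_zero quat_add.
Proof. by case=> ? ? ? ?; congr Quat => /=; ring. Qed.
Fact quat_addN : left_inverse quat_zero quat_opp quat_add.
Proof. by case=> ? ? ? ?; congr Quat => /=; ring. Qed.

HB.instance Definition _ :=
  GRing.isZmodule.Build (quaternion R) quat_addA quat_addC quat_add0 quat_addN.

Fact quat_mulA : associative quat_mul.
Proof. by case=> ? ? ? ? [? ? ? ?] [? ? ? ?]; congr Quat => /=; ring. Qed.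
Fact quat_mul1l : left_id quat_one quat_mul.
Proof. by case=> ? ? ? ?; congr Quat => /=; ring. Qed.
Fact quat_mul1r : right_id quat_one quat_mul.
Proof. by case=> ? ? ? ?; congr Quat => /=; ring. Qed.
Fact quat_mulDl : left_distributive quat_mul quat_add.
Proof. by case=> ? ? ? ? [? ? ? ?] [? ? ? ?]; congr Quat => /=; ring. Qed.
Fact quat_mulDr : right_distributive quat_mul quat_add.
Proof. by case=> ? ? ? ? [? ? ? ?] [? ? ? ?]; congr Quat => /=; ring. Qed.
Fact quat_one_neq0 : quat_one != 0.
Proof. by apply/eqP=> -[] /eqP; rewrite oner_eq0. Qed.

HB.instance Definition _ :=
  GRing.Zmodule_isNzRing.Build (quaternion R)
    quat_mulA quat_mul1l quat_mul1r quat_mulDl quat_mulDr quat_one_neq0.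

End QuaternionRing.

Section QuaternionDivision.
Variable R : realFieldType.
Implicit Types q : quaternion R.

Definition quat_normsq q : R :=
  qre q ^+ 2 + qimi q ^+ 2 + qimj q ^+ 2 + qimk q ^+ 2.

Lemma quat_normsq_eq0 q : (quat_normsq q == 0) = (q == 0).
Proof.
case: q => a b c d; rewrite /quat_normsq /=; apply/eqP/eqP; last first.
  by case=> -> -> -> ->; rewrite expr0n /= !addr0.
move=> /eqP; rewrite !paddr_eq0 ?addr_ge0 ?sqr_ge0 // !sqrf_eq0 -!andbA.
by case/and4P=> /eqP-> /eqP-> /eqP-> /eqP->.
Qed.

Definition quat_inv q : quaternion R :=
  if q == 0 then 0 else
  let N := quat_normsq q in
  Quat (qre q / N) (- qimi q / N) (- qimj q / N) (- qimk q / N).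

Fact quat_mulVl : {in [pred q : quaternion R | q != 0],
  left_inverse 1 quat_inv *%R}.
Proof.
move=> q /[!inE] q0; rewrite /quat_inv (negbTE q0).
move: q0; rewrite -quat_normsq_eq0; case: q => a b c d.
by rewrite /quat_normsq /= => N0; congr Quat => /=; field.
Qed.
Fact quat_mulVr : {in [pred q : quaternion R | q != 0],
  right_inverse 1 quat_inv *%R}.
Proof.
move=> q /[!inE] q0; rewrite /quat_inv (negbTE q0).
move: q0; rewrite -quat_normsq_eq0; case: q => a b c d.
by rewrite /quat_normsq /= => N0; congr Quat => /=; field.
Qed.
Fact quat_unitP q1 q2 :
  q2 * q1 = 1 /\ q1 * q2 = 1 -> q1 \in [pred q : quaternion R | q != 0].
Proof.
case=> h _; rewrite inE; apply/eqP=> q0.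
by move: h; rewrite q0 mulr0 => /esym/eqP; rewrite oner_eq0.
Qed.
Fact quat_inv_out : {in [predC [pred q : quaternion R | q != 0]],
  quat_inv =1 id}.
Proof. by move=> q; rewrite !inE negbK /quat_inv => /eqP->; rewrite eqxx. Qed.

HB.instance Definition _ :=
  GRing.NzRing_hasMulInverse.Build (quaternion R)
    quat_mulVl quat_mulVr quat_unitP quat_inv_out.

Lemma quat_unitE q : (q \is a GRing.unit) = (q != 0).
Proof. by []. Qed.

End QuaternionDivision.

(* A regular polynomial is represented by its family of coefficients, as an
   element [P] of [{mpoly (quaternion R)[n]}]: [P@_m] is the coefficient
   standing on the right of q_1^(m_1) ... q_n^(m_n).  In this ring the
   indeterminates commute with each other and with the coefficients, so its
   product is the *-product ([mpolyX_starM]); evaluation is not multiplicative,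
   and [meval] does not apply, as it needs commutative coefficients. *)
Definition reg_eval (R : comNzRingType) (n : nat) (a : 'I_n -> quaternion R)
    (P : {mpoly (quaternion R)[n]}) : quaternion R :=
  \sum_(m <- msupp P) (\prod_(i < n) a i ^+ m i) * P@_m.

(* H[q_1, ..., q_k] inside H[q_1, ..., q_n]; as ['I_n] starts at 0, the
   variables q_1, ..., q_k are those of index less than k. *)
Definition in_first_vars (R : comNzRingType) (n k : nat)
    (P : {mpoly (quaternion R)[n]}) : Prop :=
  forall m, m \in msupp P -> forall i : 'I_n, (k <= i)%N -> m i = 0%N.

Lemma mpolyX_starM (R : comNzRingType) (n : nat) (l k : 'X_{1..n})
    (a b : quaternion R) :
  ('X_[l] * a%:MP) * ('X_[k] * b%:MP)
  = 'X_[l + k] * (a * b)%:MP :> {mpoly (quaternion R)[n]}.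
Proof.
rewrite mpolyXD mpolyCM !mulrA; congr (_ * _).
by rewrite -!mulrA; congr (_ * _); apply: commr_mpolyX.
Qed.

Lemma reg_eval_widen (R : comNzRingType) (n k : nat) (a : 'I_n -> quaternion R)
    (P : {mpoly (quaternion R)[n]}) : (msize P <= k)%N ->
  reg_eval a P = \sum_(m : 'X_{1..n < k}) (\prod_(i < n) a i ^+ m i) * P@_m.
Proof.
move=> lek; rewrite /reg_eval (big_mksub ('X_{1..n < k} : subFinType _)) ?msupp_uniq //=; last first.
  by move=> m /msize_mdeg_lt /leq_trans; apply.
by rewrite big_rmcond //= => m /memN_msupp_eq0 ->; rewrite mulr0.
Qed.

Lemma digits_inj (n k : nat) (f g : 'I_n -> nat) :
  (forall i, f i < k)%N -> (forall i, g i < k)%N ->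
  (\sum_(i < n) f i * k ^ i = \sum_(i < n) g i * k ^ i)%N -> f =1 g.
Proof.
elim: n f g => [|n IHn] f g fk gk; first by move=> _ [].
have k0 : (0 < k)%N by apply: leq_ltn_trans (fk ord0).
have shift (h : 'I_n.+1 -> nat) : (\sum_(i < n.+1) h i * k ^ i
    = (\sum_(i < n) h (lift ord0 i) * k ^ i) * k + h ord0)%N.
  rewrite big_ord_recl expn0 muln1 addnC big_distrl /=; congr (_ + _)%N.
  by apply: eq_bigr => i _; rewrite expnS -mulnA (mulnC (k ^ i)%N).
rewrite !shift => e.
have e0 : f ord0 = g ord0.
  by move: (congr1 (modn^~ k) e); rewrite !modnMDl !modn_small.
have eS : (fun i => f (lift ord0 i)) =1 (fun i => g (lift ord0 i)).
  apply: IHn => //.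
  move: (congr1 (divn^~ k) e); rewrite !divnMDl // !divn_small ?addn0 //.
by move=> i; case: (unliftP ord0 i) => [j ->|->].
Qed.

Section RegEvalInj.
Variable R : realFieldType.

Definition quat_real (x : R) : quaternion R := Quat x 0 0 0.
Lemma quat_realM : {morph quat_real : x y / x * y}.
Proof. by move=> x y; congr Quat => /=; ring. Qed.
Lemma quat_realX x e : quat_real x ^+ e = quat_real (x ^+ e).
Proof. by elim: e => // e IH; rewrite !exprS IH quat_realM. Qed.
Lemma quat_real_prod (I : Type) (s : seq I) (F : I -> R) :
  \prod_(i <- s) quat_real (F i) = quat_real (\prod_(i <- s) F i).
Proof. by elim/big_rec2: _ => // i x y _ ->; rewrite quat_realM. Qed.

Lemma poly_nat_inj (p q : {poly R}) : (forall t : R, p.[t] = q.[t]) -> p = q.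
Proof.
move=> h; apply/eqP; rewrite -subr_eq0; apply/eqP.
apply: (@roots_geq_poly_eq0 _ _ [seq i%:R | i <- iota 0 (size (p - q))]).
- by apply/allP=> x _; rewrite rootE !hornerE h subrr.
- by rewrite map_inj_uniq ?iota_uniq // => i j /eqP; rewrite eqr_nat => /eqP.
- by rewrite size_map size_iota.
Qed.

(* A regular polynomial is determined by the function it defines, so that the
   coefficient families and the functions H^n -> H are interchangeable. *)
Theorem reg_eval_inj (n : nat) (P Q : {mpoly (quaternion R)[n]}) :
  (forall a, reg_eval a P = reg_eval a Q) -> P = Q.
Proof.
move=> h; pose k := maxn (msize P) (msize Q).
have [leP leQ] : (msize P <= k)%N /\ (msize Q <= k)%N.
  by rewrite leq_maxl leq_maxr.
pose e (m : 'X_{1..n < k}) := (\sum_(i < n) m i * k ^ i)%N.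
have e_inj : injective e.
  have ltk (m : 'X_{1..n < k}) i : (m i < k)%N.
    apply: leq_ltn_trans (bmdeg m).
    by rewrite mdegE (bigD1 i) //= leq_addr.
  move=> m1 m2 /digits_inj e12; apply/val_inj/mnmP => i.
  by apply: e12 => j; apply: ltk.
pose F (c : quaternion R -> R) (S : {mpoly (quaternion R)[n]}) : {poly R} :=
  \sum_(m : 'X_{1..n < k}) c S@_m *: 'X^(e m).
have Fcoef c S m : (F c S)`_(e m) = c S@_m.
  rewrite coef_sum (bigD1 m) //= coefZ coefXn eqxx mulr1 big1 ?addr0 //.
  by move=> m' /negbTE m'm; rewrite coefZ coefXn (inj_eq e_inj) eq_sym m'm mulr0.
pose pt t (i : 'I_n) := quat_real (t ^+ (k ^ i)).
have Feval (c : quaternion R -> R) S t : c 0 = 0 ->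
    {morph c : x y / x + y} -> (forall x q, c (quat_real x * q) = x * c q) ->
    (msize S <= k)%N -> (F c S).[t] = c (reg_eval (pt t) S).
  move=> c0 cD cZ leS; rewrite (reg_eval_widen _ leS) (big_morph c cD c0).
  rewrite horner_sum; apply: eq_bigr => m _.
  rewrite hornerZ hornerXn mulrC; under eq_bigr do rewrite quat_realX -exprM.
  rewrite quat_real_prod cZ; congr (_ * _); rewrite -expr_sum; congr (_ ^+ _).
  by apply: eq_bigr => i _; rewrite mulnC.
have Fc (c : quaternion R -> R) : c 0 = 0 ->
    {morph c : x y / x + y} -> (forall x q, c (quat_real x * q) = x * c q) ->
    forall m : 'X_{1..n < k}, c P@_m = c Q@_m.
  move=> c0 cD cZ m; rewrite -!Fcoef; suff -> : F c P = F c Q by [].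
  by apply: poly_nat_inj => t; rewrite !Feval // h.
apply/mpolyP => m; case: (ltnP (mdeg m) k) => [ltmk|lekm]; last first.
  have supp0 (S : {mpoly (quaternion R)[n]}) : (msize S <= k)%N -> S@_m = 0.
    by move=> leS; apply/memN_msupp_eq0/msize_mdeg_ge/(leq_trans leS lekm).
  by rewrite !supp0.
have {}Fc c c0 cD cZ : c P@_m = c Q@_m := Fc c c0 cD cZ (BMultinom ltmk).
have reZ x q : qre (quat_real x * q) = x * qre q.
  by case: q => ? ? ? ?; rewrite /= !mul0r !subr0.
have iZ x q : qimi (quat_real x * q) = x * qimi q.
  by case: q => ? ? ? ?; rewrite /= !mul0r subr0 !addr0.
have jZ x q : qimj (quat_real x * q) = x * qimj q.
  by case: q => ? ? ? ?; rewrite /= !mul0r subr0 !addr0.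
have kZ x q : qimk (quat_real x * q) = x * qimk q.
  by case: q => ? ? ? ?; rewrite /= !mul0r subr0 !addr0.
have hre := Fc (@qre R) erefl (fun _ _ => erefl) reZ.
have hi := Fc (@qimi R) erefl (fun _ _ => erefl) iZ.
have hj := Fc (@qimj R) erefl (fun _ _ => erefl) jZ.
have hk := Fc (@qimk R) erefl (fun _ _ => erefl) kZ.
move: hre hi hj hk; case: P@_m => a b c d; case: Q@_m => a' b' c' d' /=.
by move=> -> -> -> ->.
Qed.

End RegEvalInj.

(* Main.v *)
Require Import Defs.
From mathcomp Require Import all_boot all_order all_algebra.
From mathcomp Require Import reals.
From mathcomp.multinomials Require Import mpoly.

(** Evaluation at [a] is additive but not multiplicative: a coefficient standing
    on the right may be pulled through the indeterminates of the polynomial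
    ring, but not through the entries of [a]. It does respect the one product
    that matters here. If [m] involves only the variables up to [k], then
    [a k] is the last factor of the ordered product of powers prescribed by
    ['X_k * 'X_[m]], so it can be read equally well as the last power or as a
    left factor of the coefficient. Hence [('X_k - (a k)%:MP) * Q] vanishes at
    [a] as soon as [Q] involves only the variables up to [k]
    ([reg_eval_linear_factor]).

    Read backwards, the same exchange is a division algorithm: modulo such
    products, the last variable of a monomial can be absorbed, one power at a
    time, into the coefficient. Every polynomial is therefore congruent to a
    constant ([const_mod_linear_span]). By the first part that constant is the
    value at [a], so it is zero exactly when the polynomial vanishes there. *)

Set Implicit Arguments.
Unset Strict Implicit.
Unset Printing Implicit Defensive.

Import GRing.Theory.
Local Open Scope ring_scope.

(** The order of the factors is what makes this true in a noncommutative ring: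
    all the factors to the right of the [k]-th one are equal to 1. *)
Lemma prod_expr_last (A : nzRingType) (n : nat) (a : 'I_n -> A)
    (m : 'I_n -> nat) (k : 'I_n) :
  (forall i : 'I_n, (k < i)%N -> m i = 0%N) ->
  \prod_(i < n) a i ^+ ((k == i) + m i) = (\prod_(i < n) a i ^+ m i) * a k.
Proof.
elim: n a m k => [|n IHn] a m k; first by case: k.
case: (unliftP ord0 k) => [j ->|->] m0; rewrite !big_ord_recl /=.
  rewrite add0n -mulrA -IHn => [|i ji]; last by apply: m0.
  by congr (_ * _); apply: eq_bigr => i _; rewrite (inj_eq lift_inj).
by rewrite big1 => [|i _]; [rewrite !mulr1 -exprSr | rewrite m0].
Qed.

Section RegularEvaluation.
Variables (R : comNzRingType) (n : nat) (a : 'I_n -> quaternion R).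
Implicit Types (P Q : {mpoly (quaternion R)[n]}) (m : 'X_{1..n}).

Lemma reg_evalD P Q : reg_eval a (P + Q) = reg_eval a P + reg_eval a Q.
Proof.
pose d := maxn (msize (P + Q)) (maxn (msize P) (msize Q)).
rewrite !(@reg_eval_widen _ _ d) ?leq_max ?leqnn ?orbT // -big_split.
by apply: eq_bigr => m _; rewrite mcoeffD mulrDr.
Qed.

Lemma reg_eval0 : reg_eval a 0 = 0.
Proof. by rewrite /reg_eval msupp0 big_nil. Qed.

Lemma reg_eval_sum (I : Type) (s : seq I) (F : I -> {mpoly (quaternion R)[n]}) :
  reg_eval a (\sum_(i <- s) F i) = \sum_(i <- s) reg_eval a (F i).
Proof. exact: (big_morph _ reg_evalD reg_eval0). Qed.

Lemma reg_evalZX c m :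
  reg_eval a (c *: 'X_[m]) = (\prod_(i < n) a i ^+ m i) * c.
Proof.
have le_size : (msize (c *: 'X_[m] : {mpoly (quaternion R)[n]}) <= (mdeg m).+1)%N.
  by apply: leq_trans (msizeZ_le _ _) _; rewrite msizeX.
rewrite (reg_eval_widen _ le_size) (bigD1 (BMultinom (ltnSn (mdeg m)))) //=.
rewrite mcoeffZ mcoeffX eqxx mulr1 [X in _ + X]big1 ?addr0 // => m' neq_m'.
rewrite mcoeffZ mcoeffX; case: eqVneq => [eq_m|_]; last by rewrite !mulr0.
by case/eqP: neq_m'; apply: val_inj.
Qed.

Lemma reg_evalC c : reg_eval a c%:MP = c.
Proof.
by rewrite -alg_mpolyC -mpolyX0 reg_evalZX big1 ?mul1r // => i _; rewrite mnm0E.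
Qed.

(** Multiplication by a linear factor exchanges a last variable for a left
    factor of the coefficient. *)
Lemma mul_linear_factorZX (k : 'I_n) b c m :
  ('X_k - b%:MP) * (c *: 'X_[m])
  = c *: 'X_[U_(k) + m] - (b * c) *: 'X_[m] :> {mpoly (quaternion R)[n]}.
Proof.
rewrite mulrBl mul_mpolyC scalerA; congr (_ - _).
rewrite -!mul_mpolyC mulrA -(commr_mpolyX U_(k)%MM c%:MP).
by rewrite -mulrA -mpolyXD.
Qed.

Lemma reg_eval_linear_factor (k : 'I_n) Q :
  in_first_vars k.+1 Q -> reg_eval a (('X_k - (a k)%:MP) * Q) = 0.
Proof.
move=> Qk; rewrite [Q]mpolyE mulr_sumr reg_eval_sum big_seq big1 // => m mQ.
rewrite mul_linear_factorZX -scaleNr reg_evalD !reg_evalZX.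
under eq_bigr do rewrite mnmDE mnm1E.
rewrite prod_expr_last => [|i]; last exact: Qk.
by rewrite mulrN mulrA subrr.
Qed.

(** In general this additive subgroup is neither a left nor a right ideal:
    ['X_0 - (a 0)%:MP] multiplied on the left by a constant that does not commute
    with [a 0], or on the right by ['X_1] when [a 0] and [a 1] do not commute,
    no longer vanishes at [a]. Only closure under sums is available. *)
Definition linear_span P : Prop :=
  exists Pk : 'I_n -> {mpoly (quaternion R)[n]},
    (forall k : 'I_n, in_first_vars k.+1 (Pk k)) /\
    P = \sum_(k < n) ('X_k - (a k)%:MP) * Pk k.

Lemma reg_eval_linear_span P : linear_span P -> reg_eval a P = 0.
Proof.
case=> Pk [Pk_vars ->]; rewrite reg_eval_sum big1 // => k _.
exact: reg_eval_linear_factor.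
Qed.

Lemma linear_span0 : linear_span 0.
Proof.
exists (fun=> 0); split=> [k m|]; first by rewrite msupp0.
by rewrite big1 // => k _; rewrite mulr0.
Qed.

Lemma linear_spanD P Q : linear_span P -> linear_span Q -> linear_span (P + Q).
Proof.
case=> Pk [Pk_vars ->] [Qk [Qk_vars ->]].
exists (fun k => Pk k + Qk k); split=> [k m|].
  move/msuppD_le; rewrite mem_cat => /orP[]; first exact: Pk_vars.
  exact: Qk_vars.
by rewrite -big_split; apply: eq_bigr => k _; rewrite mulrDr.
Qed.

Lemma linear_span_factor (k : 'I_n) Q :
  in_first_vars k.+1 Q -> linear_span (('X_k - (a k)%:MP) * Q).
Proof.
move=> Qk; exists (fun j => if j == k then Q else 0); split=> [j m|].
  by case: eqVneq => [->|_]; [apply: Qk | rewrite msupp0].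
rewrite (bigD1 k) //= eqxx big1 ?addr0 // => j /negbTE ->.
by rewrite mulr0.
Qed.

Lemma mnm_last_var m :
  m != 0%MM -> exists k m', m = (U_(k) + m')%MM /\
    forall i : 'I_n, (k < i)%N -> m' i = 0%N.
Proof.
move=> m_neq0.
have [k0 mk0] : exists k, m k != 0%N.
  apply/existsP; apply: contraNT m_neq0 => /existsPn m0.
  by apply/eqP/mnmP => i; rewrite mnm0E; apply/eqP; rewrite -[_ == _]negbK m0.
case: (@arg_maxnP _ k0 (fun k => m k != 0%N) (@nat_of_ord n) mk0) => k mk kmax.
have Uk_le : (U_(k) <= m)%MM.
  apply/mnm_lepP => i; rewrite mnm1E; case: eqVneq => [<-|//].
  by rewrite lt0n.
exists k, (m - U_(k))%MM; split=> [|i ki].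
  by rewrite addmC submK.
have -> : (m - U_(k))%MM i = (m i - (k == i))%N by rewrite mnmBE mnm1E.
apply/eqP; rewrite subn_eq0; apply: leq_trans (leq0n _).
by rewrite leqn0; apply: contraLR ki => /kmax; rewrite -leqNgt.
Qed.

(** Peeling off the last variable keeps the cofactor within the variables that
    [linear_span] allows, and lowers the degree. *)
Lemma monomial_mod_linear_span c m :
  exists d, linear_span (c *: 'X_[m] - d%:MP).
Proof.
have [e] := ubnP (mdeg m); elim: e => // e IHe in c m *; rewrite ltnS => le_me.
have [-> | /mnm_last_var[k [m' [m_eq m'0]]]] := eqVneq m 0%MM.
  by exists c; rewrite mpolyX0 alg_mpolyC subrr; apply: linear_span0.
have [|d span_d] := IHe (a k * c) m'.
  by apply: leq_trans le_me; rewrite m_eq mdegD mdeg1 add1n.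
exists d; rewrite m_eq.
rewrite -(subrK ((a k * c) *: 'X_[m']) (c *: 'X_[_])) -mul_linear_factorZX -addrA.
apply: linear_spanD => //; apply: linear_span_factor => m'' m''_supp i lt_ki.
by move/msuppZ_le: m''_supp; rewrite msuppX inE => /eqP ->; apply: m'0.
Qed.

Lemma const_mod_linear_span P : exists d, linear_span (P - d%:MP).
Proof.
rewrite [P]mpolyE; elim/big_rec: _ => [|m Q _ [d span_d]].
  by exists 0; rewrite mpolyC0 subrr; apply: linear_span0.
have [d' span_d'] := monomial_mod_linear_span P@_m m.
exists (d' + d); rewrite mpolyCD opprD addrACA.
exact: linear_spanD.
Qed.

End RegularEvaluation.

(* The ring product is the *-product; [k : 'I_n] stands for the paper's k + 1. *)
Theorem proposition3p10 (R : realType) (n : nat)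
    (P : {mpoly (quaternion R)[n]}) (a : 'I_n -> quaternion R) :
  reg_eval a P = 0 <->
  exists Pk : 'I_n -> {mpoly (quaternion R)[n]},
    (forall k : 'I_n, in_first_vars k.+1 (Pk k)) /\
    P = \sum_(k < n) ('X_k - (a k)%:MP) * Pk k.
Proof.
split=> [P0|]; last exact: reg_eval_linear_span.
have [d span_d] := const_mod_linear_span a P.
have := reg_evalD a (P - d%:MP) d%:MP.
rewrite subrK P0 reg_evalC (reg_eval_linear_span span_d) add0r => d0.
by move: span_d; rewrite -d0 mpolyC0 subr0.
Qed.
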